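(* For any $t\in\mathbb{N}$, any $t$-function of the class of split graphs is polynomially $\chi$-bounded with $\chi$-binding function $g(x)=x^{2^{2t}}$.
   Context: All graphs are finite and simple; a class of graphs is a set of graphs closed under isomorphism. A split graph is a graph whose vertex set can be partitioned into an independent set and a clique. For a graph $G$ and distinct vertices $u,w$, $G(u,w)=1$ if they are adjacent and $0$ otherwise. If $G,H_1,\dots,H_k$ are graphs on the same vertex set $V$, $G$ is a (boolean) function of $H_1,\dots,H_k$ if there is a boolean function $f:\{0,1\}^k\to\{0,1\}$ with $G(a,b)=f(H_1(a,b),\dots,H_k(a,b))$ for all distinct $a,b\in V$. A class $\mathcal{Y}$ is a $t$-function of $\mathcal{X}$ if every $G\in\mathcal{Y}$ is a function of at most $t$ graphs from $\mathcal{X}$ (on the vertex set of $G$). A class $\mathcal{Y}$ is $\chi$-bounded with $\chi$-binding function $g$ if $\chi(H)\le g(\omega(H))$ for every induced subgraph $H$ of every graph in $\mathcal{Y}$ ($\chi$ = chromatic number, $\omega$ = clique number); it is polynomially $\chi$-bounded if such $g$ can be taken to be a polynomial. *)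

(* Defs.v *)
From HB Require Import structures.
From mathcomp Require Import all_boot all_order all_algebra.
Set Implicit Arguments.
Unset Strict Implicit.
Unset Printing Implicit Defensive.
Import GRing.Theory.

Record sgraph (V : finType) := SGraph {
  adj :> rel V;
  adj_sym : symmetric adj;
  adj_irr : irreflexive adj
}.

Definition graph_iso (V W : finType) (G : sgraph V) (H : sgraph W) : Prop :=
  exists2 h : V -> W, bijective h & forall x y, H (h x) (h y) = G x y.

Record graph_class := GraphClass {
  in_class :> forall V : finType, sgraph V -> Prop;
  iso_closed : forall (V W : finType) (G : sgraph V) (H : sgraph W),
    graph_iso G H -> in_class G -> in_class H
}.

Section Notions.
Variables (V : finType) (G : sgraph V).

Definition clique (S : {set V}) : bool :=
  [forall x in S, forall y in S, (x != y) ==> G x y].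

Definition independent (S : {set V}) : bool :=
  [forall x in S, forall y in S, ~~ G x y].

(* Either part of the partition may be empty. *)
Definition is_split : Prop :=
  exists A : {set V}, independent A /\ clique (~: A).

Definition clique_number : nat := \max_(S : {set V} | clique S) #|S|.

Definition colorable (k : nat) : bool :=
  [exists c : {ffun V -> 'I_k}, forall x, forall y, G x y ==> (c x != c y)].

Fact colorable_ex : exists k, colorable k.
Proof.
exists #|V|; apply/existsP; exists [ffun x => enum_rank x].
apply/forallP=> x; apply/forallP=> y; apply/implyP=> Gxy; rewrite !ffunE.
by apply: contraTneq Gxy => /enum_rank_inj->; rewrite adj_irr.
Qed.

Definition chromatic_number : nat := ex_minn colorable_ex.

Variable S : {set V}.

Definition induced_adj : rel {x : V | x \in S} :=
  fun x y => G (val x) (val y).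

Fact induced_sym : symmetric induced_adj.
Proof. by move=> x y; apply: adj_sym. Qed.

Fact induced_irr : irreflexive induced_adj.
Proof. by move=> x; apply: adj_irr. Qed.

Definition induced : sgraph {x : V | x \in S} := SGraph induced_sym induced_irr.

End Notions.

Fact is_split_iso (V W : finType) (G : sgraph V) (H : sgraph W) :
  graph_iso G H -> is_split G -> is_split H.
Proof.
case=> h [g hK gK] hGH [A [/forall_inP indA /forall_inP clA]].
exists (g @^-1: A); split; apply/forall_inP=> x xA; apply/forall_inP=> y yA.
  rewrite !inE in xA yA; rewrite -(gK x) -(gK y) hGH.
  by move/forall_inP: (indA _ xA); apply.
rewrite -(inj_eq (can_inj gK)) -[in H x](gK x) -[in H _ y](gK y) hGH.
have [gxA gyA] : g x \in ~: A /\ g y \in ~: A by rewrite !inE in xA yA *.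
by move/forall_inP: (clA _ gxA); apply.
Qed.

Definition split_graphs : graph_class := GraphClass is_split_iso.

Definition boolean_function (V : finType) (k : nat)
    (G : sgraph V) (H : 'I_k -> sgraph V) : Prop :=
  exists f : k.-tuple bool -> bool,
    forall a b : V, a != b -> G a b = f [tuple H i a b | i < k].

Definition t_function (t : nat) (X Y : graph_class) : Prop :=
  forall (V : finType) (G : sgraph V), Y V G ->
    exists (k : nat) (H : 'I_k -> sgraph V),
      [/\ k <= t, forall i, X V (H i) & boolean_function G H].

Definition chi_binding (Y : graph_class) (g : nat -> nat) : Prop :=
  forall (V : finType) (G : sgraph V), Y V G -> forall S : {set V},
    chromatic_number (induced G S) <= g (clique_number (induced G S)).

Definition polynomial_fun (g : nat -> nat) : Prop :=
  exists p : {poly rat}, forall n : nat, ((g n)%:R = p.[n%:R])%R.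

Definition polynomially_chi_bounded (Y : graph_class) : Prop :=
  exists2 g : nat -> nat, polynomial_fun g & chi_binding Y g.

(* Main.v *)
Require Import Defs.
From HB Require Import structures.
From mathcomp Require Import all_boot all_order all_algebra.

(** If [G] is a function of the split graphs [H_1, ..., H_k], fix a split
    partition of each [H_i] and sort the vertices by the sides on which they lie.
    Two vertices with the same sides are adjacent in [H_i] or not according to
    their common side, so each of the [2^k] sorts is a clique or an independent set
    of [G].  Colouring the sorts with disjoint palettes of [omega] colours gives
    [chi <= 2^k omega], which is at most [omega^(k+1)] when [omega >= 2]; a graph
    with [omega <= 1] has no edges. *)

Set Implicit Arguments.
Unset Strict Implicit.
Unset Printing Implicit Defensive.
Import GRing.Theory.

Section Colouring.
Variables (V : finType) (G : sgraph V).

Lemma proper_colorable (C : finType) (c : V -> C) :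
  (forall x y, G x y -> c x != c y) -> colorable G #|C|.
Proof.
move=> proper; apply/existsP; exists [ffun x => enum_rank (c x)].
apply/forallP=> x; apply/forallP=> y; apply/implyP=> /proper.
by rewrite !ffunE (inj_eq enum_rank_inj).
Qed.

Lemma chromatic_number_le k : colorable G k -> chromatic_number G <= k.
Proof. by rewrite /chromatic_number; case: ex_minnP => m _; apply. Qed.

Lemma clique_number_ge (S : {set V}) : clique G S -> #|S| <= clique_number G.
Proof. by move=> clS; apply: (leq_bigmax_cond (F := fun S : {set V} => #|S|)). Qed.

Lemma clique_number_gt0 (x : V) : 0 < clique_number G.
Proof.
rewrite -(cards1 x); apply: clique_number_ge.
apply/forall_inP=> y /set1P->; apply/forall_inP=> z /set1P->.
by rewrite eqxx.
Qed.

Lemma clique_number_edge x y : G x y -> 1 < clique_number G.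
Proof.
move=> Gxy; have neq_xy : x != y by apply: contraTneq Gxy => ->; rewrite adj_irr.
have <- : #|[set x; y]| = 2 by rewrite cards2 neq_xy.
apply: clique_number_ge; apply/forall_inP=> u uxy; apply/forall_inP=> v vxy.
apply/implyP; case/set2P: uxy => ->; case/set2P: vxy => ->; rewrite ?eqxx //.
by rewrite adj_sym.
Qed.

Lemma homogeneous_partition_colorable (T : finType) (s : V -> T) (b : T -> bool) :
    (forall x y, x != y -> s x = s y -> G x y = b (s x)) ->
  colorable G (#|T| * clique_number G).
Proof.
move=> homog; case Dw: (clique_number G) => [|w].
  (* Every vertex is a clique of size one, so here [V] is empty and no colours are needed. *)
  have noV (x : V) : False by have := clique_number_gt0 x; rewrite Dw.
  rewrite muln0 -card_void; apply: (@proper_colorable _ (fun x => match noV x with end)).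
  by move=> x; case: (noV x).
pose sort x := [set y | s y == s x].
(* An independent sort may have more than [w.+1] elements, and [inord] then sends the excess indices
   to 0. This is harmless: ranks only have to be distinct inside clique sorts, which have at most
   [w.+1] elements. *)
pose rank x : 'I_w.+1 := inord (index x (enum (sort x))).
rewrite -[w.+1]card_ord -card_prod; apply: (@proper_colorable _ (fun x => (s x, rank x))).
move=> x y Gxy; apply: contraTneq (Gxy) => -[eq_s eq_rank].
have [<- | neq_xy] := eqVneq x y; first by rewrite adj_irr.
(* A single edge inside the sort of [x] makes the whole sort a clique. *)
have b_sx : b (s x) by rewrite -(homog x y).
have eq_sort : sort y = sort x by rewrite /sort eq_s.
have sort_le : #|sort x| <= w.+1.
  rewrite -Dw; apply: clique_number_ge; apply/forall_inP=> u; rewrite inE => /eqP su.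
  apply/forall_inP=> v; rewrite inE => /eqP sv; apply/implyP=> neq_uv.
  by rewrite homog ?su ?sv.
have rankK z : z \in sort x -> index z (enum (sort x)) < w.+1.
  by move=> zx; apply: leq_trans sort_le; rewrite cardE index_mem mem_enum.
have xx : x \in sort x by rewrite inE.
have yx : y \in sort x by rewrite inE eq_s.
move/(congr1 val): eq_rank; rewrite /rank /= eq_sort !inordK ?rankK // => eq_index.
have eq_xy : x = y.
  by rewrite -[x](nth_index x (s := enum (sort x))) ?eq_index ?nth_index ?mem_enum.
by rewrite eq_xy eqxx in neq_xy.
Qed.

Lemma chromatic_number_le_expn k n :
    k < n -> colorable G (2 ^ k * clique_number G) ->
  chromatic_number G <= clique_number G ^ n.
Proof.
move=> lt_kn col; have n_gt0 : 0 < n by apply: leq_ltn_trans lt_kn.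
have [w_gt1 | w_le1] := ltnP 1 (clique_number G).
  apply: leq_trans (chromatic_number_le col) _.
  apply: leq_trans (leq_pexp2l (ltnW w_gt1) lt_kn).
  (* The exponent 0 is treated apart because [leq_exp2r] requires a positive one. *)
  by rewrite expnSr leq_mul //; case: (k) => // j; rewrite leq_exp2r.
case Dw: (clique_number G) w_le1 col => [|[|//]] _ col.
  by rewrite muln0 in col; apply: leq_trans (chromatic_number_le col) _.
rewrite exp1n; apply: chromatic_number_le; rewrite -card_unit.
apply: (@proper_colorable _ (fun=> tt)) => x y /clique_number_edge.
by rewrite Dw.
Qed.

End Colouring.

Lemma split_function_sort (V : finType) (G : sgraph V) k (H : 'I_k -> sgraph V) :
    (forall i, is_split (H i)) -> boolean_function G H ->
  exists (s : V -> k.-tuple bool) (b : k.-tuple bool -> bool),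
    forall x y, x != y -> s x = s y -> G x y = b (s x).
Proof.
move=> splitH [f fG]; have [A splitA] := fin_all_exists splitH.
(* The bit [x \notin A i] is true on the clique side, so for two vertices of the same sort it is
   also their adjacency in [H i]. Hence [f] itself serves as [b]. *)
exists (fun x => [tuple x \notin A i | i < k]), f => x y neq_xy eq_s.
rewrite fG //; congr f; apply: eq_from_tnth => i; rewrite !tnth_mktuple.
have := congr1 (fun u : k.-tuple bool => tnth u i) eq_s; rewrite /= !tnth_mktuple => eq_side.
have [/forall_inP indA /forall_inP clA] := splitA i.
case xA: (x \in A i) in eq_side *.
  apply/negbTE; have /forall_inP := indA _ xA; apply.
  exact/negPn/negbT/esym.
have xnA : x \in ~: A i by rewrite inE xA.
have /forall_inP/(_ y) := clA _ xnA; rewrite inE -eq_side neq_xy.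
exact.
Qed.

Lemma split_function_chi_binding (t : nat) (Y : graph_class) :
  t_function t split_graphs Y -> chi_binding Y (fun x => x ^ (2 ^ (2 * t))).
Proof.
move=> hY V G YG S; have [k [H [le_kt splitH GH]]] := hY V G YG.
have [s [b homog]] := split_function_sort splitH GH.
apply: (@chromatic_number_le_expn _ _ k).
  (* The exponent suffices since [k <= t <= 2 * t < 2 ^ (2 * t)]. *)
  apply: leq_ltn_trans (ltn_expl (2 * t) (isT : 1 < 2)).
  by apply: leq_trans le_kt _; rewrite leq_pmull.
rewrite -[X in X ^ k]card_bool -card_tuple.
(* The sorts of [G] restrict to [S] and stay homogeneous in the induced subgraph. *)
apply: (@homogeneous_partition_colorable _ _ _ (s \o val) b) => x y neq_xy.
by apply: homog; rewrite (inj_eq val_inj).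
Qed.

Lemma polynomial_fun_expn n : polynomial_fun (fun x => x ^ n).
Proof. by exists ('X^n)%R => x; rewrite hornerXn natrX. Qed.

Theorem theorem5p7 (t : nat) (Y : graph_class) (hY : t_function t split_graphs Y) :
  polynomially_chi_bounded Y /\ chi_binding Y (fun x : nat => x ^ (2 ^ (2 * t))).
Proof.
have binding := split_function_chi_binding hY.
split=> //; exists (fun x => x ^ (2 ^ (2 * t))) => //.
exact: polynomial_fun_expn.
Qed.
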